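(* Let $(W,T)$ be a dual Coxeter system of type $B_n$. Then every parabolic quasi-Coxeter element $w\in W$ for $(W,T)$ is a classical parabolic Coxeter element.
   Context: A dual Coxeter system $(W,T)$ of (finite) rank $n$ consists of a group $W$ and a subset $T\subseteq W$ such that there is a subset $S\subseteq T$ with $|S|=n$, $(W,S)$ a Coxeter system, and $T=\{wsw^{-1}\mid w\in W, s\in S\}$. A simple system for $(W,T)$ is any subset $S'\subseteq T$ such that $(W,S')$ is a Coxeter system; all simple systems have the same cardinality $n$. For finite $W$ all simple systems determine the same Coxeter diagram, and the type of $(W,T)$ is the type of $(W,S)$ for any simple system $S$. Fix a simple system $S=\{s_1,\dots,s_n\}$ for $(W,T)$. For $w\in W$, $\mathrm{Red}_T(w)$ denotes the set of all tuples $(t_1,\dots,t_m)\in T^m$ with $w=t_1\cdots t_m$ and $m$ minimal; this minimal $m$ is denoted $\ell_T(w)$. The absolute order is defined by $u<_T v$ if and only if $\ell_T(u)+\ell_T(u^{-1}v)=\ell_T(v)$. An element $c\in W$ is a classical Coxeter element if it is conjugate in $W$ to $s_{\pi(1)}\cdots s_{\pi(n)}$ for some permutation $\pi$ of $\{1,\dots,n\}$. An element $w\in W$ is a classical parabolic Coxeter element if $w<_T c$ for some classical Coxeter element $c$. An element $w\in W$ is a parabolic quasi-Coxeter element for $(W,T)$ if there are a simple system $S'=\{s_1',\dots,s_n'\}$ for $(W,T)$, some $m\le n$, and $(t_1,\dots,t_m)\in\mathrm{Red}_T(w)$ such that $\langle t_1,\dots,t_m\rangle=\langle s_1',\dots,s_m'\rangle$.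 *)

(* Defs.v *)
From HB Require Import structures.
From mathcomp Require Import all_boot all_fingroup.

Set Implicit Arguments.
Unset Strict Implicit.
Unset Printing Implicit Defensive.

Local Open Scope group_scope.

Section DualCoxeter.

Variable gT : finGroupType.
Implicit Types (W : {group gT}) (S T : {set gT}).

(* W is presented by the generators S (of order 2) and the relations
   (s * t) ^+ #[s * t] = 1, for s, t in S. The last clause is the universal
   property of this presentation; H ranges over all groups, finite or not. For
   s = t the relation reads f s * f s = 1. *)
Definition coxeter_system W S : Prop :=
  [/\ {in S, forall s, #[s] = 2},
      <<S>> = W
    & forall (H : groupType) (f : gT -> H),
        {in S &, forall s t, (f s * f t) ^+ #[s * t] = 1} ->
        exists phi : gT -> H,
          {in W &, {morph phi : x y / x * y}} /\ {in S, phi =1 f}].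

Definition enumerates n (s : 'I_n -> gT) S : Prop :=
  injective s /\ S = [set s i | i : 'I_n].

Definition simple_system W T S : Prop :=
  S \subset T /\ coxeter_system W S.

(* The Coxeter matrix of the diagram o---o-- ... --o-4-o on the nodes
   0, ..., n.-1. *)
Definition coxeter_matrix_B n (i j : 'I_n) : nat :=
  if i == j then 1%N
  else if (i.+1 == j) || (j.+1 == i) then
    (if maxn i j == n.-1 then 4 else 3)
  else 2.

(* The type is read off a simple system S with T = {w s w^-1}; for finite W
   it does not depend on the choice of the simple system. *)
Definition dual_coxeter_system_of_type n (M : 'I_n -> 'I_n -> nat) W T : Prop :=
  exists S (s : 'I_n -> gT),
    [/\ simple_system W T S,
        enumerates s S,
        T = [set w * r * w^-1 | w in W, r in S]
      & forall i j, #[s i * s j] = M i j].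

Definition is_factorization T (w : gT) (t : seq gT) : Prop :=
  {subset t <= T} /\ w = \prod_(r <- t) r.

Definition Red T (w : gT) (t : seq gT) : Prop :=
  is_factorization T w t /\
  forall t', is_factorization T w t' -> size t <= size t'.

(* l_T(w) = m, as a relation. *)
Definition absolute_length T (w : gT) (m : nat) : Prop :=
  exists2 t, Red T w t & size t = m.

(* l_T(u) + l_T(u^-1 v) = l_T(v); in particular u = v is allowed. *)
Definition absolute_order T (u v : gT) : Prop :=
  exists a b, [/\ absolute_length T u a,
                  absolute_length T (u^-1 * v) b
                & absolute_length T v (a + b)].

Definition classical_coxeter_element W n (s : 'I_n -> gT) (c : gT) : Prop :=
  exists (pi : 'S_n) (x : gT),
    x \in W /\ c = x * (\prod_(i < n) s (pi i)) * x^-1.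

Definition classical_parabolic_coxeter_element
    W T n (s : 'I_n -> gT) (w : gT) : Prop :=
  w \in W /\
  exists2 c, classical_coxeter_element W s c & absolute_order T w c.

Definition parabolic_quasi_coxeter_element W T n (w : gT) : Prop :=
  exists S' (s' : 'I_n -> gT) (m : nat) (t : m.-tuple gT),
    [/\ simple_system W T S',
        enumerates s' S',
        m <= n,
        Red T w t
      & <<[set r in t]>> = <<[set s' i | i : 'I_n & i < m]>>].

End DualCoxeter.

(* Main.v *)
Require Import Defs.
From mathcomp Require Import all_boot all_fingroup zify.

Set Implicit Arguments.
Unset Strict Implicit.
Unset Printing Implicit Defensive.

(* A group of type B_n is identified with the group of permutations of 2n
   signed points that commute with the negation: the Coxeter relations give the
   representation, and an enumeration of the cosets of the tail subgroups
   <s_{k+1}, ..., s_{n-1}> in <s_k, ..., s_{n-1}> shows it is faithful.  A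
   reflection then acts as one transposition (when odd) or as a product of two.

   If n reflections generate W, they act transitively on the 2n points, and one
   of them is odd; so their product is a product of at most 2n - 1
   transpositions generating a transitive group, which forces it to be a
   2n-cycle.  Any two 2n-cycles commuting with the negation are conjugate in W,
   and the same count shows that a 2n-cycle has reflection length n.  Given
   w = t_1 ... t_m with <t_1, ..., t_m> = <s'_1, ..., s'_m>, the reflections
   t_1, ..., t_m, s'_{m+1}, ..., s'_n generate W, so their product lies above w
   and is conjugate to s_1 ... s_n. *)

(** * Products of transpositions and full cycles of a finite set *)

Section Permutations.

Local Open Scope group_scope.

Variable X : finType.
Implicit Types (a b : {perm X}) (l : seq (X * X)) (x y : X).

Lemma tperm_invariantP (K : Type) (f : X -> K) (e : X * X) :
  f e.1 = f e.2 -> forall z, f (tperm e.1 e.2 z) = f z.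
Proof. by move=> fe z; case: tpermP => [->|->|]. Qed.

Lemma prod_tperm_invariant (K : Type) (f : X -> K) l :
  {in l, forall e, f e.1 = f e.2} ->
  forall z, f ((\prod_(e <- l) tperm e.1 e.2) z) = f z.
Proof.
elim: l => [|e l IHl] fl z; first by rewrite big_nil perm1.
rewrite big_cons permM IHl => [|e' e'l]; last first.
  by apply: fl; rewrite inE e'l orbT.
by apply: tperm_invariantP; apply: fl; rewrite mem_head.
Qed.

(* [f] merges the two points of each transposition in turn.  Adding tperm x y
   raises the number of cycles by at most 1; when [f] separates x and y, it
   joins two cycles, so that it lowers both that number and #|codom f| by 1. *)
Lemma prod_tperm_porbits l : exists f : X -> X,
  {in l, forall e, f e.1 = f e.2} /\
  #|porbits (\prod_(e <- l) tperm e.1 e.2)| + #|X| <= size l + 2 * #|codom f|.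
Proof.
elim: l => [|[x y] l [f [fl IH]]].
  exists id; split=> //; rewrite big_nil /= add0n mul2n -addnn.
  rewrite (card_codom (f := id)) //.
  by rewrite leq_add2r /porbits (leq_trans (leq_imset_card _ _)).
pose P := \prod_(e <- l) tperm e.1 e.2.
have fP z : f (P z) = f z by exact: prod_tperm_invariant.
have fPorb z : x \in porbit P z -> f x = f z.
  by case/porbitP=> i ->; elim: i z => [|i IHi] z;
    rewrite ?perm1 // expgS permM IHi.
have := porbits_mul_tperm P x y; rewrite big_cons /= -/P in IH *.
case: (eqVneq (f x) (f y)) => [fxy|nfxy] count.
  exists f; split; first by move=> e /[1!inE] /orP[/eqP->|/fl].
  move: IH count; rewrite -/P; case: (x != y); case: (x \notin _) => /=; lia.
exists (fun z => if f z == f y then f x else f z); split.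
  move=> e /[1!inE] /orP[/eqP->/=|/fl -> //].
  by rewrite eqxx (negbTE nfxy).
set f' := fun z : X => _.
have sub : #|codom f| <= #|codom f'|.+1.
  have -> : #|codom f'|.+1 = #|codom f' | + #|[set f y]|.
    by rewrite cards1 addn1.
  apply: leq_trans (_ : #|[predU codom f' & [set f y]]| <= _); last first.
    by rewrite -cardUI leq_addr.
  apply: subset_leq_card; apply/subsetP=> _ /codomP[z ->]; rewrite !inE.
  case: (eqVneq (f z) (f y)) => [_|nz]; first by rewrite orbT.
  by apply/orP; left; apply/codomP; exists z; rewrite /f' (negbTE nz).
have nx : x \notin porbit P y by apply: contra nfxy => /fPorb ->.
have nxy : x != y by apply: contraNneq nfxy => ->.
by move: IH count sub; rewrite -/P nx nxy /=; lia.
Qed.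

Definition full_cycle a : Prop := forall x y, y \in porbit a x.

Lemma full_cycleP a : #|porbits a| <= 1 -> full_cycle a.
Proof.
move=> le1 x y; rewrite porbit_sym -eq_porbit_mem.
by apply/eqP/(card_le1_eqP le1); apply: imset_f.
Qed.

Lemma card_porbits_full_cycle a (x : X) : full_cycle a -> #|porbits a| = 1%N.
Proof.
move=> fa; suff -> : porbits a = [set porbit a x] by rewrite cards1.
apply/setP=> A; rewrite inE; apply/imsetP/eqP => [[y _ ->]|->];
  last by exists x.
by apply/eqP; rewrite eq_porbit_mem.
Qed.

(** The orbit of [x] is all of [X], so the first [#|X|] iterates of [x] are distinct and the next
    one is [x] again. *)
Lemma full_cycle_eq a x i j : full_cycle a ->
  ((a ^+ i) x == (a ^+ j) x) = (i == j %[mod #|X|]).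
Proof.
move=> fa; have XE : porbit a x = setT by apply/setP=> y; rewrite fa inE.
have cX : #|porbit a x| = #|X| by rewrite XE cardsT.
have modE k : (a ^+ k) x = (a ^+ (k %% #|X|)) x.
  rewrite {1}(divn_eq k #|X|) expgD permM; congr ((a ^+ _) _).
  elim: (k %/ _) => [|q IHq]; first by rewrite perm1.
  by rewrite mulSn expgD permM (permX _ _ #|X|) -{2}cX iter_porbit.
have X0 : 0 < #|X| by apply/card_gt0P; exists x.
have := uniq_traject_porbit a x; rewrite cX => Ut.
rewrite (modE i) (modE j) !permX.
have nthE k : iter (k %% #|X|) a x = nth x (traject a x #|X|) (k %% #|X|).
  by rewrite nth_traject ?ltn_mod.
by rewrite !nthE nth_uniq ?size_traject ?ltn_mod.
Qed.

(* Some power of a full cycle [a] agrees with [nu] at one point, hence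
   everywhere; as [nu] is an involution, it is [a ^+ n]. *)
Lemma full_cycle_involution (nu a : {perm X}) n x : #|X| = n.*2 ->
  (forall y, nu (nu y) = y) -> (forall y, nu y != y) ->
  commute nu a -> full_cycle a -> nu = a ^+ n.
Proof.
move=> cX nuK nuN nua fa; have [j nux] := porbitP _ _ _ (fa x (nu x)).
have nuE : nu = a ^+ j.
  apply/permP=> y; have [k ->] := porbitP _ _ _ (fa x y).
  by rewrite -permM -(commuteX k nua) permM nux -!permM -!expgD addnC.
have /eqP : (a ^+ (j + j)) x = (a ^+ 0) x by rewrite expgD permM -nuE nuK perm1.
have : (a ^+ j) x != (a ^+ 0) x by rewrite -nuE perm1.
rewrite !full_cycle_eq // cX mod0n => nj /eqP j2.
rewrite nuE; apply/permP=> y; apply/eqP; rewrite full_cycle_eq // cX.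
have n0 : 0 < n by rewrite -double_gt0 -cX; apply/card_gt0P; exists x.
have /dvdnP[q jq] : n %| j.
  by rewrite -(dvdn_pmul2r (p := 2)) // !muln2 /dvdn -[in X in X %% _]addnn j2.
(* An even [q] would make [nu] fix [x]; an odd [q] leaves exactly [a ^+ n]. *)
move: nj; rewrite {}jq -(odd_double_half q); case: (odd q) => /=.
  by rewrite add1n mulSn -doubleMl doubleMr addnC modnMDl.
by rewrite -doubleMl doubleMr modnMl eqxx.
Qed.

(** The conjugator sends [(a ^+ k) x] to [(b ^+ k) x]. It carries [a ^+ n] to [b ^+ n], and both
    powers equal [nu], so it commutes with [nu]. *)
Lemma full_cycle_conj (nu a b : {perm X}) n (x : X) : #|X| = n.*2 ->
  (forall y, nu (nu y) = y) -> (forall y, nu y != y) ->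
  commute nu a -> commute nu b -> full_cycle a -> full_cycle b ->
  exists2 g : {perm X}, commute nu g & a ^ g = b.
Proof.
move=> cX nuK nuN nua nub fa fb.
have ex y : {k : nat | y == (a ^+ k) x}.
  by apply/sigW; have [k ->] := porbitP _ _ _ (fa x y); exists k.
pose K y := sval (ex y).
have KE y : (a ^+ K y) x = y by rewrite -(eqP (svalP (ex y))).
pose h y := (b ^+ K y) x.
have hX k : h ((a ^+ k) x) = (b ^+ k) x.
  by apply/eqP; rewrite full_cycle_eq // -(full_cycle_eq x _ _ fa) KE.
have h_inj : injective h.
  move=> y z /eqP; rewrite full_cycle_eq // -(full_cycle_eq x _ _ fa) !KE.
  by move/eqP.
have ha k y : h ((a ^+ k) y) = (b ^+ k) (h y).
  by rewrite -[y in LHS]KE -permM -expgD hX expgD permM.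
have nuaE := full_cycle_involution x cX nuK nuN nua fa.
have nubE := full_cycle_involution x cX nuK nuN nub fb.
exists (perm h_inj).
  by apply/permP=> y; rewrite !permM !permE {1}nuaE ha -nubE.
by apply/permP=> y;
  rewrite -[y](permKV (perm h_inj)) permJ !permE -[a]expg1 ha expg1.
Qed.

End Permutations.

(** * Coset enumeration from the braid relations of type B *)

Section CosetEnumeration.

Local Open Scope group_scope.

Variables (gT : finGroupType) (n : nat) (u : nat -> gT).

Hypothesis u_inv : forall i, i < n -> u i * u i = 1.
Hypothesis u_comm : forall i j, i.+1 < j -> j < n -> u i * u j = u j * u i.
Hypothesis u_braid3 : forall i, i.+2 < n ->
  u i * u i.+1 * u i = u i.+1 * u i * u i.+1.
Hypothesis u_braid4 : forall i, i.+2 = n ->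
  u i * u i.+1 * u i * u i.+1 = u i.+1 * u i * u i.+1 * u i.

(* The palindrome 0, ..., n-2, n-1, n-2, ..., 0: on the 2n signed points, the
   simple reflection that swaps q and q+1 has index [mirror q]. *)
Definition mirror q := minn q (n.*2.-2 - q).

Lemma mirror_lo q : q < n -> mirror q = q.
Proof. by rewrite /mirror; lia. Qed.

Lemma mirror_hi q : n <= q.+1 -> mirror q = n.*2.-2 - q.
Proof. by rewrite /mirror; lia. Qed.

Definition tail_group k : {group gT} := <<[set u i | i : 'I_n & k <= i]>>%G.

(** For [k <= q < n.*2 - k], this word carries the point [k] to the point [q] in the
    signed-permutation model. *)
Definition coset_word k q := \prod_(k <= j < q) u (mirror j).

Definition tail_coset k q := tail_group k.+1 :* coset_word k q.

Lemma rcosetM3 (A : {set gT}) a b c : A :* a :* b :* c = A :* (a * b * c).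
Proof. by rewrite !rcosetM. Qed.

Lemma rcosetM4 (A : {set gT}) a b c d :
  A :* a :* b :* c :* d = A :* (a * b * c * d).
Proof. by rewrite !rcosetM. Qed.

Lemma mem_tail_group k i : k <= i -> i < n -> u i \in tail_group k.
Proof.
move=> ki ltin; apply: mem_gen; apply/imsetP.
by exists (Ordinal ltin); rewrite ?inE.
Qed.

Lemma tail_cosetS k q : k <= q ->
  tail_coset k q.+1 = tail_coset k q :* u (mirror q).
Proof.
by move=> kq; rewrite /tail_coset /coset_word big_nat_recr //= rcosetM.
Qed.

(* [tail_coset k q] plays the role of the point q, so [u i] should fix it unless
   [u i] moves q.  Either [u i] commutes with the last letter of the coset word,
   or it equals the letter before it; a braid relation then turns it into a
   letter fixing an earlier coset. *)
Lemma tail_coset_fix k q i : k <= q -> q < n.*2 - k -> k <= i -> i < n ->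
  i != mirror q -> (k < q -> i != mirror q.-1) ->
  tail_coset k q :* u i = tail_coset k q.
Proof.
elim/ltn_ind: q i => q IH i kq qn ki ltin iq iq1.
have [kq' | qk] := ltnP k q; last first.
  have {kq qk} eqk : q = k by lia.
  rewrite eqk in iq *; rewrite /tail_coset /coset_word big_geq // mulg1.
  by apply/rcoset_id/mem_tail_group => //; move: iq; rewrite /mirror; lia.
case: q => // q in IH kq qn iq iq1 kq' *.
have {}iq1 := iq1 kq'; rewrite /= in iq1.
have miq : mirror q < n by rewrite /mirror; lia.
have [far | near] := boolP ((i.+1 < mirror q) || ((mirror q).+1 < i)).
  have cm : u (mirror q) * u i = u i * u (mirror q).
    by case/orP: far => [lt|lt]; first symmetry; exact: u_comm.
  rewrite tail_cosetS // -rcosetM cm rcosetM (IH q _ i) //; first by lia.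
  by move: far; rewrite /mirror; lia.
(* Now [i] is next to [mirror q]; since [mirror q.+1] is excluded, only the preceding letter of the
   palindrome is left. *)
have [kq1 iE] : k < q /\ i = mirror q.-1.
  have [lt | ge] := ltnP q n.
    have qn1 : q.+1 < n.
      rewrite ltn_neqAle lt andbT; apply/eqP => qn1.
      move: near iq iq1; rewrite (mirror_lo lt) (@mirror_hi q.+1) ?qn1 //; lia.
    rewrite (@mirror_lo q.-1); last by lia.
    by move: near iq iq1; rewrite !mirror_lo //; lia.
  rewrite (@mirror_hi q.-1); last by lia.
  by move: near iq iq1; rewrite !mirror_hi; lia.
case: q => // q in IH kq qn iq iq1 kq' miq near kq1 iE *.
rewrite /= in iE; have kq2 : k <= q by [].
have [in1 | in1] := eqVneq i n.-1; last first.
  have [br km m0 m1] : [/\ u (mirror q) * u (mirror q.+1) * u i =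
        u (mirror q.+1) * u (mirror q) * u (mirror q.+1),
      k <= mirror q.+1, mirror q.+1 != mirror q
    & k < q -> mirror q.+1 != mirror q.-1].
    have [lt | ge] := ltnP q.+1 n.
      have q2n : q.+2 < n.
        rewrite ltn_neqAle lt andbT; apply/eqP => q2n.
        by move: iq iE; rewrite mirror_hi ?mirror_lo; lia.
      rewrite (mirror_lo (ltnW lt)) in iE *; rewrite (mirror_lo lt) iE.
      split; [exact: u_braid3 | lia | lia |].
      by rewrite mirror_lo; lia.
    have nq : n <= q.
      rewrite leqNgt; apply/negP => qn'; have qE : q = n.-1 by lia.
      by move: iE in1; rewrite mirror_lo; lia.
    have m1E : mirror q.+1 = n.*2.-2 - q.+1 by apply: mirror_hi; lia.
    have m0E : mirror q = n.*2.-2 - q by apply: mirror_hi; lia.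
    have miE : i = (mirror q.+1).+1 by lia.
    split; [| lia | lia | rewrite (@mirror_hi q.-1); lia].
    by rewrite -iE miE -u_braid3 // -miE; lia.
  rewrite !tail_cosetS // rcosetM3 br -rcosetM3.
  by rewrite (IH q _ (mirror q.+1)) //; lia.
(* The word ends at the top of the palindrome, with letters [r], [r.+1], [r] where [n = r.+2], and
   [i = r.+1]. The relation with four letters moves [u r.+1] to the front, where it fixes
   [tail_coset k r]. *)
have qE : q = n.-1 by move: iE qn iq in1; rewrite /mirror; lia.
have [r nE] : exists r, n = r.+2 by exists n.-2; lia.
have qE' : q = r.+1 by lia.
have kr : k <= r by lia.
rewrite qE' in IH *; rewrite !tail_cosetS; try lia.
have -> : mirror r = r by rewrite /mirror; lia.
have -> : mirror r.+1 = r.+1 by rewrite /mirror; lia.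
have -> : mirror r.+2 = r by rewrite /mirror; lia.
have -> : i = r.+1 by lia.
rewrite rcosetM4 u_braid4; last by lia.
rewrite -rcosetM4 (IH r _ r.+1) //; rewrite /mirror; lia.
Qed.

Lemma tail_coset_move k q i : k <= q -> q < n.*2 - k -> k <= i -> i < n ->
  exists q', [/\ k <= q', q' < n.*2 - k &
    tail_coset k q :* u i = tail_coset k q'].
Proof.
move=> kq qn ki ltin.
have [iq | iq] := eqVneq i (mirror q).
  have [q1n | q1n] := ltnP q.+1 (n.*2 - k).
    by exists q.+1; split; [lia | lia | rewrite tail_cosetS // iq].
  (* At the last point, [mirror q] would be [k.-1], too small for [i], unless [k = 0]. Then
     truncated subtraction gives [mirror q = 0 = mirror q.-1], so [u i] steps back. *)
  have k0 : k = 0 by move: iq ki; rewrite /mirror; lia.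
  exists q.-1; split; try lia.
  have {1}-> : q = q.-1.+1 by lia.
  have -> : i = mirror q.-1 by move: iq; rewrite /mirror; lia.
  rewrite tail_cosetS; last by lia.
  by rewrite -rcosetM u_inv ?rcoset1 ?mulg1 //; rewrite /mirror; lia.
have [/andP[kq1 /eqP iq1]|nq1] := boolP ((k < q) && (i == mirror q.-1)).
  exists q.-1; split; try lia.
  have {1}-> : q = q.-1.+1 by lia.
  rewrite tail_cosetS; last by lia.
  by rewrite -rcosetM -iq1 u_inv ?mulg1.
exists q; split=> //; apply: tail_coset_fix => // kq1.
by move: nq1; rewrite kq1.
Qed.

(** The coset for [q = k] contains 1, and right multiplication by a generator maps the listed cosets
    among themselves, so they cover the group. *)
Lemma tail_group_cosets k x : k < n -> x \in tail_group k ->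
  exists2 q, k <= q < n.*2 - k & x \in tail_coset k q.
Proof.
move=> kn /gen_prodgP[m [c cA ->{x}]]; elim: m c cA => [|m IH] c cA.
  exists k; first by lia.
  by rewrite big_ord0 /tail_coset /coset_word big_geq // mulg1 group1.
rewrite big_ord_recr /=;
  have [i|q /andP[kq qn] xq] := IH (c \o widen_ord (leqnSn m)).
  exact: cA.
have /imsetP[i /[!inE] ki ->] := cA ord_max.
have [q' [kq' qn' eqC]] := tail_coset_move kq qn ki (ltn_ord i).
by exists q'; rewrite ?kq' // -eqC mem_rcoset mulgK.
Qed.

End CosetEnumeration.

(** * The simple reflections as permutations of the signed points *)

Section SignedPermutations.

Local Open Scope group_scope.

Variable n : nat.

(* The point p < n stands for the basis vector e_p and the point 2n - 1 - p for
   its opposite; [swap_nat i] is the identity for i >= n. *)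
Definition swap_nat i p :=
  if n <= i then p
  else if (p == i) || (p + i.+2 == n.*2) then p.+1
  else if (p == i.+1) || (p + i.+1 == n.*2) then p.-1
  else p.

(** A linear form of the case analysis, with the image named [q], so that [lia] can compare
    composites. *)
Lemma swap_natP (i p : nat) : i < n -> exists2 q, swap_nat i p = q &
  (p = i \/ p + i.+2 = n.*2) /\ q = p.+1 \/
  (p = i.+1 \/ p + i.+1 = n.*2) /\ p = q.+1 \/
  p <> i /\ p <> i.+1 /\ p + i.+2 <> n.*2 /\ p + i.+1 <> n.*2 /\ q = p.
Proof.
move=> ltin; exists (swap_nat i p) => //; rewrite /swap_nat leqNgt ltin /=.
case: ifP => [/orP[/eqP|/eqP]|/norP[/eqP p1 /eqP p2]]; try lia.
case: ifP => [/orP[/eqP|/eqP]|/norP[/eqP p3 /eqP p4]]; lia.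
Qed.

Ltac swap_step q p ltin :=
  have [q -> /=] := swap_natP p ltin;
  case=> [[[?|?] ?]|[[[?|?] ?]|[? [? [? [? ?]]]]]]; try (exfalso; lia).

Ltac swap_eval p ltin q :=
  let H := fresh in have [q -> H] := swap_natP p ltin;
  first [ have {}H : q = p.+1 by lia
        | have {}H : q = p.-1 by lia
        | have {}H : q = p by lia ].

Lemma swap_nat_lt i p : p < n.*2 -> swap_nat i p < n.*2.
Proof.
case: (leqP n i) => [ni|lt_in]; first by rewrite /swap_nat ni.
by have [q -> ?] := swap_natP p lt_in; lia.
Qed.

Definition swap_ord i (p : 'I_n.*2) :
  'I_n.*2 := Ordinal (swap_nat_lt i (ltn_ord p)).

Lemma swap_natK i p : swap_nat i (swap_nat i p) = p.
Proof.
case: (leqP n i) => [ni|lt_in]; first by rewrite /swap_nat ni.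
by have [q -> ?] := swap_natP p lt_in; have [r -> ?] := swap_natP q lt_in; lia.
Qed.

Lemma swap_ord_inj i : injective (swap_ord i).
Proof. by apply: (can_inj (g := swap_ord i)) => p; apply: val_inj;
  exact: swap_natK. Qed.

Definition sigma i : {perm 'I_n.*2} := perm (@swap_ord_inj i).

Definition neg : {perm 'I_n.*2} := perm (@rev_ord_inj n.*2).

Lemma sigmaE i p : sigma i p = swap_nat i p :> nat.
Proof. by rewrite permE. Qed.

Lemma negE p : neg p = n.*2 - p.+1 :> nat.
Proof. by rewrite permE. Qed.

Lemma negK p : neg (neg p) = p.
Proof. by rewrite !permE rev_ordK. Qed.

Lemma neg_neq p : neg p != p.
Proof. by rewrite -val_eqE /= negE; case: p => /= p; lia. Qed.

Lemma sigma_inv i : sigma i * sigma i = 1.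
Proof.
by apply/permP=> p; apply: val_inj; rewrite permM perm1 /= !sigmaE swap_natK.
Qed.

Lemma sigma_neg i : i < n -> commute neg (sigma i).
Proof.
move=> lt_in; apply/permP=> p; apply: val_inj;
  rewrite !permM /= !(sigmaE, negE).
case: p => /= p lp; have [q -> ?] := swap_natP p lt_in.
by have [r -> ?] := swap_natP (n.*2 - p.+1) lt_in; lia.
Qed.

Lemma sigma_comm i j :
  i.+1 < j -> j < n -> sigma i * sigma j = sigma j * sigma i.
Proof.
move=> ij jn; have lt_in : i < n by lia.
apply/permP=> p; apply: val_inj; rewrite !permM /= !sigmaE; case: p => p /= lp.
  swap_step q1 p lt_in; swap_step q2 q1 jn;
  swap_step r1 p jn; swap_step r2 r1 lt_in; lia.
Qed.

Lemma sigma_braid3 i : i.+2 < n ->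
  sigma i * sigma i.+1 * sigma i = sigma i.+1 * sigma i * sigma i.+1.
Proof.
move=> i2n; have i1n : i.+1 < n by lia.
have lt_in : i < n by lia.
apply/permP=> p; apply: val_inj; rewrite !permM /= !sigmaE; case: p => p /= lp.
  swap_step q1 p lt_in; swap_step q2 q1 i1n;
  swap_step r1 p i1n; swap_step r2 r1 lt_in;
  swap_step q3 q2 lt_in; swap_step r3 r2 i1n; lia.
Qed.

Lemma sigma_braid4 i : i.+2 = n ->
  sigma i * sigma i.+1 * sigma i * sigma i.+1 =
  sigma i.+1 * sigma i * sigma i.+1 * sigma i.
Proof.
move=> i2n; have i1n : i.+1 < n by lia.
have lt_in : i < n by lia.
apply/permP=> p; apply: val_inj; rewrite !permM /= !sigmaE; case: p => p /= _.
(* Only the four central points [i], ..., [i.+3] can move. Once the position of [p] is fixed, each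
   of the eight swaps is evaluated without branching. *)
have : p = i \/ p = i.+1 \/ p = i.+2 \/ p = i.+3 \/ p < i \/ i.+3 < p by lia.
case=> [?|[?|[?|[?|[?|?]]]]];
  swap_eval p lt_in q1; swap_eval q1 i1n q2;
  swap_eval q2 lt_in q3; swap_eval q3 i1n q4;
  swap_eval p i1n r1; swap_eval r1 lt_in r2;
  swap_eval r2 i1n r3; swap_eval r3 lt_in r4; lia.
Qed.

Lemma tperm_natP N (a b p : 'I_N) :
  p = a :> nat /\ tperm a b p = b :> nat \/ p = b :> nat /\ tperm a b p = a :>
    nat \/
  p <> a :> nat /\ p <> b :> nat /\ tperm a b p = p :> nat.
Proof.
case: tpermP => [->|->|pa pb]; [by left | by right; left | right; right].
by split; [move/val_inj | split=> // /val_inj].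
Qed.

(** The points [n.-1] and [n] are opposite, so the two swaps that make up a simple reflection
    coincide here. *)
Lemma sigma_last_tperm i : i.+1 = n ->
  exists a b : 'I_n.*2, a != b /\ sigma i = tperm a b.
Proof.
move=> i1n; have lt_in : i < n by lia.
have ai : i < n.*2 by lia.
have bi : i.+1 < n.*2 by lia.
exists (Ordinal ai), (Ordinal bi); split; first by rewrite -val_eqE /=; lia.
apply/permP=> p; apply: val_inj; rewrite /= sigmaE.
have [q -> ?] := swap_natP p lt_in.
have := tperm_natP (Ordinal ai) (Ordinal bi) p; rewrite /=.
move: (nat_of_ord (tperm _ _ p)) => r; lia.
Qed.

(** The parity of [sigma i] is counted as a number: an odd reflection needs at most one
    transposition, an even one at most two. *)
Lemma sigma_tperm i : i < n -> exists l : seq ('I_n.*2 * 'I_n.*2),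
  sigma i = \prod_(e <- l) tperm e.1 e.2 /\ size l + sigma i <= 2.
Proof.
move=> lt_in; have [/sigma_last_tperm[a [b [_ ->]]] | i1n] :
  i.+1 = n \/ i.+1 < n by lia.
  by exists [:: (a, b)]; rewrite big_seq1 /=; split=> //; case: odd_perm.
have ai : i < n.*2 by lia.
have bi : i.+1 < n.*2 by lia.
have ci : n.*2 - i.+2 < n.*2 by lia.
have di : n.*2 - i.+1 < n.*2 by lia.
pose a := Ordinal ai; pose b := Ordinal bi; pose c := Ordinal ci;
  pose d := Ordinal di.
exists [:: (a, b); (c, d)].
have E : sigma i = tperm a b * tperm c d.
  apply/permP=> p; apply: val_inj; rewrite /= permM sigmaE.
  have [q -> ?] := swap_natP p lt_in.
  have := tperm_natP c d (tperm a b p); have := tperm_natP a b p; rewrite /=.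
  move: (tperm c d _) => r' ? ?; lia.
split; first by rewrite big_cons big_seq1.
by rewrite E odd_permM !odd_tperm -!val_eqE /=; lia.
Qed.

End SignedPermutations.

(** * Coxeter relations of two involutions in braid form *)

Section Involutions.

Local Open Scope group_scope.

Variables (gT : finGroupType) (x y : gT).
Hypotheses (xx : x * x = 1) (yy : y * y = 1).

(** In [(x * y) ^+ m = 1], the last [m] letters form the inverse [b'] of one side [b] of the braid
    relation, and the first [m] letters are the other side. *)
Lemma eq_invol_word (a b b' : gT) : b * b' = 1 -> (a = b) <-> (a * b' = 1).
Proof.
move=> bb; split=> [->//|ab]; apply: (mulIg b'); by rewrite ab bb.
Qed.

Lemma expg2_comm : (x * y) ^+ 2 = 1 <-> x * y = y * x.
Proof.
rewrite !expgS expg0 mulg1 (@eq_invol_word _ (y * x) (x * y)) ?mulgA //.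
by rewrite -(mulgA y) xx mulg1 yy.
Qed.

Lemma expg3_braid : (x * y) ^+ 3 = 1 <-> x * y * x = y * x * y.
Proof.
rewrite !expgS expg0 mulg1 (@eq_invol_word _ (y * x * y) (y * x * y)) ?mulgA //.
by rewrite -(mulgA _ y y) yy mulg1 -(mulgA _ x x) xx mulg1 yy.
Qed.

Lemma expg4_braid : (x * y) ^+ 4 = 1 <-> x * y * x * y = y * x * y * x.
Proof.
rewrite !expgS expg0 mulg1 (@eq_invol_word _ (y * x * y * x) (x * y * x * y))
  ?mulgA //.
by rewrite -(mulgA _ x x) xx mulg1 -(mulgA _ y y) yy mulg1 -(mulgA _ x x) xx
  mulg1 yy.
Qed.

Lemma expg_mulC_invol m : (x * y) ^+ m = 1 -> (y * x) ^+ m = 1.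
Proof.
have xV : x^-1 = x by apply/eqP; rewrite eq_invg_mul xx.
have yV : y^-1 = y by apply/eqP; rewrite eq_invg_mul yy.
have -> : y * x = (x * y)^-1 by rewrite invMg xV yV.
by rewrite expgVn => ->; rewrite invg1.
Qed.

End Involutions.

(** * The isomorphism with the centralizer of the negation *)

Section HyperoctahedralModel.

Local Open Scope group_scope.

Variables (gT : finGroupType) (W : {group gT}) (n : nat) (S : {set gT}) (s :
  'I_n -> gT).
Hypotheses (cox : coxeter_system W S) (enum_s : enumerates s S)
  (cox_B : forall i j, #[s i * s j] = coxeter_matrix_B i j).

Let u (i : nat) : gT := if insub i is Some j then s j else 1.

Let uE (i : 'I_n) : u i = s i.
Proof. by rewrite /u valK. Qed.

Let u_order i j (lt_in : i < n) (ltjn : j < n) :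
  #[u i * u j] = coxeter_matrix_B (Ordinal lt_in) (Ordinal ltjn).
Proof. by rewrite -cox_B -!uE. Qed.

Let u_inv i : i < n -> u i * u i = 1.
Proof.
move=> lt_in; apply/eqP; rewrite -order_eq1 (u_order lt_in lt_in).
by rewrite /coxeter_matrix_B eqxx.
Qed.

Let u_comm i j : i.+1 < j -> j < n -> u i * u j = u j * u i.
Proof.
move=> ij ltjn; have lt_in : i < n by lia.
apply/(expg2_comm (u_inv lt_in) (u_inv ltjn)).
have <- : #[u i * u j] = 2; last exact: expg_order.
rewrite (u_order lt_in ltjn) /coxeter_matrix_B -val_eqE /=.
by do 2!(case: ifP => ?; first by lia).
Qed.

Let u_braid3 i : i.+2 < n -> u i * u i.+1 * u i = u i.+1 * u i * u i.+1.
Proof.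
move=> i2n; have lt_in : i < n by lia.
have i1n : i.+1 < n by lia.
apply/(expg3_braid (u_inv lt_in) (u_inv i1n)).
have <- : #[u i * u i.+1] = 3; last exact: expg_order.
rewrite (u_order lt_in i1n) /coxeter_matrix_B -val_eqE /= eqxx /=.
by do 2!(case: ifP => ?; first by lia).
Qed.

Let u_braid4 i : i.+2 = n ->
  u i * u i.+1 * u i * u i.+1 = u i.+1 * u i * u i.+1 * u i.
Proof.
move=> i2n; have lt_in : i < n by lia.
have i1n : i.+1 < n by lia.
apply/(expg4_braid (u_inv lt_in) (u_inv i1n)).
have <- : #[u i * u i.+1] = 4; last exact: expg_order.
rewrite (u_order lt_in i1n) /coxeter_matrix_B -val_eqE /= eqxx /=.
case: ifP => ?; first by lia.
by case: ifP => ?; lia.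
Qed.

Lemma sigma_coxeter (i j : 'I_n) :
  (sigma n i * sigma n j) ^+ coxeter_matrix_B i j = 1.
Proof.
wlog ij : i j / i <= j.
  move=> le; have [|/ltnW ji] := leqP i j; first exact: le.
  have -> : coxeter_matrix_B i j = coxeter_matrix_B j i.
    by rewrite /coxeter_matrix_B eq_sym orbC maxnC.
  by apply: expg_mulC_invol; rewrite ?sigma_inv ?le.
have [si sj] := (sigma_inv n i, sigma_inv n j).
rewrite /coxeter_matrix_B -val_eqE /=.
case: eqP => [->|nij]; first by rewrite sj expg1n.
have [/orP far|adj] := boolP ((i.+1 == j) || (j.+1 == i)); last first.
  by apply/expg2_comm => //; apply: sigma_comm => //; lia.
have -> : nat_of_ord j = i.+1 by case: far => /eqP; lia.
case: ifP => jn.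
  by apply/expg4_braid; rewrite ?sigma_inv // sigma_braid4 //;
    have := ltn_ord j; lia.
by apply/expg3_braid; rewrite ?sigma_inv // sigma_braid3 //;
  have := ltn_ord j; lia.
Qed.

(** The permutations [sigma n i] satisfy the Coxeter relations, so the universal property applies to
    the permutation group. *)
Lemma sigma_representation :
  exists phi : {morphism W >-> {perm 'I_n.*2}}, forall i, phi (s i) = sigma n i.
Proof.
have [_ _ univ] := cox; have [s_inj SE] := enum_s.
pose f x := if [pick i | s i == x] is Some i then sigma n i else 1.
have fs i : f (s i) = sigma n i.
  by rewrite /f; case: pickP => [j /eqP/s_inj -> //|/(_ i)]; rewrite eqxx.
have [|phi [phiM phiS]] := univ {perm 'I_n.*2} f.
  move=> x y; rewrite SE => /imsetP[i _ ->] /imsetP[j _ ->].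
  by rewrite !fs cox_B sigma_coxeter.
exists (Morphism phiM) => i /=; rewrite -fs; apply: phiS.
by rewrite SE imset_f.
Qed.

Section Representation.

Variable phi : {morphism W >-> {perm 'I_n.*2}}.
Hypothesis phi_s : forall i, phi (s i) = sigma n i.

Let phi_u i : i < n -> phi (u i) = sigma n i.
Proof. by move=> lt_in; rewrite -(phi_s (Ordinal lt_in)) -uE. Qed.

Let u_W i : i < n -> u i \in W.
Proof.
have [_ <- _] := cox; have [_ ->] := enum_s => lt_in.
by apply: mem_gen; apply/imsetP; exists (Ordinal lt_in); rewrite // -uE.
Qed.

Let tail_group0 : tail_group n u 0 = W.
Proof.
have [_ WE _] := cox; have [_ SE] := enum_s.
apply: val_inj; rewrite /= -WE SE; congr <<_>>.
by apply/setP=> x; apply/imsetP/imsetP => [] [i _ xE]; exists i;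
  rewrite ?inE ?xE ?uE.
Qed.

Let tail_group_sub k : tail_group n u k \subset W.
Proof. by rewrite gen_subG; apply/subsetP=> _ /imsetP[i _ ->]; apply: u_W. Qed.

Let tail_group_n : tail_group n u n = 1%G.
Proof.
apply/trivGP; rewrite gen_subG; apply/subsetP=> x /imsetP[i /[!inE] le_ni xE].
by have := ltn_ord i; lia.
Qed.

Let tail_group_fix k x (p : 'I_n.*2) :
  x \in tail_group n u k -> p < k -> phi x p = p.
Proof.
move=> xk pk.
have /subsetP/(_ x xk) : tail_group n u k \subset phi @*^-1 'C[p | 'P].
  rewrite gen_subG; apply/subsetP=> _ /imsetP[i ki ->].
  rewrite inE in ki; apply: mem_morphpre; first exact: u_W.
  apply/astab1P/val_inj; rewrite /= /aperm phi_u // sigmaE.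
  by have [q -> ?] := swap_natP p (ltn_ord i); have := ltn_ord i; lia.
by case/morphpreP=> _ /astab1P.
Qed.

Let coset_word_tail k q : k <= q -> q < n.*2 - k ->
  coset_word n u k q \in tail_group n u k.
Proof.
move=> kq qn; rewrite /coset_word big_seq; apply: group_prod => j.
by rewrite mem_index_iota => jq; apply: mem_tail_group; rewrite /mirror; lia.
Qed.

Let phi_coset_word k q (p : 'I_n.*2) : p = k :> nat -> k <= q -> q < n.*2 - k ->
  phi (coset_word n u k q) p = q :> nat.
Proof.
move=> pk; elim: q => [|q IH] kq qn.
  by rewrite /coset_word big_geq // morph1 perm1; lia.
have [kq'|kq'] := leqP k q; last first.
  by rewrite /coset_word big_geq // morph1 perm1; lia.
have mq : mirror n q < n by rewrite /mirror; lia.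
have gW : coset_word n u k q \in W.
  by apply: (subsetP (tail_group_sub k)); apply: coset_word_tail => //; lia.
have -> : coset_word n u k q.+1 = coset_word n u k q * u (mirror n q).
  by rewrite /coset_word big_nat_recr.
rewrite morphM ?u_W // permM phi_u // sigmaE IH //; last by lia.
have [r ->] := swap_natP q mq; rewrite /mirror; lia.
Qed.

(** Let [x] in [tail_group n u k] act trivially and lie in the coset of index [q]. As
    [tail_group n u k.+1] fixes the point [k], [x] sends [k] to [q]; hence [q = k] and [x] lies in
    [tail_group n u k.+1]. The descent ends in the trivial group. *)
Lemma sigma_representation_inj : 'injm phi.
Proof.
apply/subsetP=> x /setIP[Wx]; rewrite !inE => /eqP.
rewrite -tail_group0 in Wx; suff H k : k <= n -> x \in tail_group n u (n - k) ->
    phi x = 1 -> x == 1 by apply: (H n); rewrite ?subnn.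
elim: k => [|k IH] kn xk x1.
  by move: xk; rewrite subn0 tail_group_n inE.
have lt_kn : n - k.+1 < n by lia.
have [q /andP[kq qn] /rcosetP[h hk xE]] :=
  tail_group_cosets u_inv u_comm u_braid3 u_braid4 lt_kn xk.
have lt_k2n : n - k.+1 < n.*2 by lia.
have qE : q = n - k.+1.
  set p := Ordinal lt_k2n; have : phi x p = p by rewrite x1 perm1.
  rewrite xE morphM; last 2 first.
  - exact: (subsetP (tail_group_sub _)) hk.
  - exact: (subsetP (tail_group_sub _)) (coset_word_tail kq qn).
  rewrite permM (tail_group_fix hk) //= => /(congr1 val) /=.
  by rewrite (@phi_coset_word (n - k.+1)).
apply: IH x1; first by lia.
move: xE; rewrite qE /coset_word big_geq // mulg1 => ->.
by have <- : (n - k.+1).+1 = n - k by lia.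
Qed.

(** For surjectivity, [b] is divided by the coset word that agrees with it at the first point not
    yet fixed. Once the points below [n] are fixed, so are their opposites. *)
Lemma sigma_representation_im : phi @* W = 'C[neg n].
Proof.
have sub : phi @* W \subset 'C[neg n].
  have [_ WE _] := cox; have [_ SE] := enum_s.
  have : <<S>> \subset phi @*^-1 'C[neg n].
    rewrite gen_subG SE; apply/subsetP=> _ /imsetP[i _ ->].
    apply: mem_morphpre; first by rewrite -uE u_W.
    by rewrite phi_s; apply/cent1P/commute_sym; exact: sigma_neg.
  by rewrite WE -sub_morphim_pre.
apply/eqP; rewrite eqEsubset sub /=; apply/subsetP=> a aneg.
suff H k : k <= n -> forall b : {perm 'I_n.*2}, b \in 'C[neg n] ->
    (forall p : 'I_n.*2, p < n - k -> b p = p) -> b \in phi @* W.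
  by apply: (H n) => // p; rewrite subnn.
elim: k => [|k IH] kn b bC bfix.
  have {bC} bneg p : b (neg n p) = neg n (b p) by rewrite -!permM (cent1P bC).
  suff -> : b = 1 by exact: group1.
  apply/permP=> p; rewrite perm1; have [pn|pn] := ltnP p n.
    by apply: bfix; rewrite subn0.
  by rewrite -[p]negK bneg bfix // negE; have := ltn_ord p; lia.
have bneg p : b (neg n p) = neg n (b p) by rewrite -!permM (cent1P bC).
have lt_k2n : n - k.+1 < n.*2 by lia.
set p := Ordinal lt_k2n; set q := nat_of_ord (b p).
(* The points below [n - k.+1] and their opposites are fixed by [b], so the image of [p] is none of
   them. *)
have kq : n - k.+1 <= q.
  rewrite leqNgt; apply/negP=> qk; have /perm_inj := bfix _ qk.
  by move/(congr1 val); rewrite /= -/q; lia.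
have qn : q < n.*2 - (n - k.+1).
  rewrite ltnNge; apply/negP=> qk.
  have : neg n (b p) < n - k.+1 by rewrite negE -/q; have := ltn_ord (b p); lia.
  move/bfix; rewrite bneg => /(congr1 (neg n)); rewrite !negK => /perm_inj.
  by move/(congr1 val); rewrite /= -/q; lia.
have gk := coset_word_tail kq qn; set g := coset_word n u _ q in gk.
have gW : g \in W by exact: (subsetP (tail_group_sub _)) gk.
have phig := mem_morphim phi gW gW.
rewrite -[b](mulgKV (phi g)) groupM //; apply: IH; first by lia.
  by rewrite groupM // groupV (subsetP sub).
move=> r rk; rewrite permM; apply/(canLR (permK _)).
have [rE|rk'] : r = p \/ r < n - k.+1.
  have [|] := ltnP r (n - k.+1); first by right.
  by left; apply: val_inj => /=; lia.
  by rewrite rE; apply: val_inj; rewrite /= (@phi_coset_word (n - k.+1)).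
by rewrite bfix // (tail_group_fix gk).
Qed.

End Representation.

End HyperoctahedralModel.

(** * Parity, transitivity and length of products of reflections *)

Section Reflections.

Local Open Scope group_scope.

Lemma full_cycle_conj_im (gT : finGroupType) (W : {group gT}) n
    (phi : {morphism W >-> {perm 'I_n.*2}}) x y :
  'injm phi -> phi @* W = 'C[neg n] ->
  x \in W -> y \in W ->
  full_cycle (phi x) -> full_cycle (phi y) ->
  exists2 z, z \in W & y = z * x * z^-1.
Proof.
move=> phi_inj phi_im Wx Wy fx fy.
suff [g gC gE] : exists2 g, g \in 'C[neg n] & phi x ^ g = phi y.
  move: gC; rewrite -phi_im => /morphimP[z _ Wz gz].
  exists z^-1; rewrite ?groupV // invgK -mulgA -conjgE.
  by apply: (injmP phi_inj); rewrite ?groupJ // morphJ // -gz gE.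
have phiC z : z \in W -> commute (neg n) (phi z).
  move=> Wz; apply/commute_sym/cent1P.
  by rewrite -phi_im mem_morphim.
(* For [n = 0] there is no base point for the cycles, but all permutations are equal. *)
case: (posnP n) => [n0|n_gt0].
  exists 1; rewrite ?group1 // conjg1; apply/permP=> p.
  by have := ltn_ord p; lia.
have lt0 : 0 < n.*2 by lia.
have [g gC gE] := full_cycle_conj (Ordinal lt0) (card_ord n.*2) (@negK n)
  (@neg_neq n) (phiC x Wx) (phiC y Wy) fx fy.
by exists g => //; apply/cent1P/commute_sym.
Qed.

Variables (gT : finGroupType) (W : {group gT}) (T : {set gT}) (n : nat).
Variable phi : {morphism W >-> {perm 'I_n.*2}}.
Hypothesis T_sub : T \subset W.
Hypothesis T_tperm : forall r, r \in T -> exists l : seq ('I_n.*2 * 'I_n.*2),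
  phi r = \prod_(e <- l) tperm e.1 e.2 /\ size l + phi r <= 2.

Implicit Types (r : seq gT) (x : gT).

Let r_sub r : {subset r <= T} -> {subset r <= W}.
Proof. by move=> rT x /rT/(subsetP T_sub). Qed.

Lemma gen_seq_sub r : {subset r <= T} -> <<[set x in r]>> \subset W.
Proof.
by move=> rT; rewrite gen_subG; apply/subsetP=> x /[!inE] /(r_sub rT).
Qed.

Lemma gen_seq_ind r (P : gT -> Prop) : P 1 ->
    (forall x y, x \in <<[set x in r]>> -> y \in r -> P x -> P (x * y)) ->
  forall x, x \in <<[set x in r]>> -> P x.
Proof.
move=> P1 PM x /gen_prodgP[m [c cr ->{x}]].
elim: m c cr => [|m IH] c cr; first by rewrite big_ord0.
rewrite big_ord_recr /=; apply: PM.
- by apply: group_prod => i _; apply: mem_gen.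
- by have := cr ord_max; rewrite inE.
- by apply: (IH (c \o widen_ord (leqnSn m))) => i; exact: cr.
Qed.

Lemma gen_seq_invariant (K : Type) (f : 'I_n.*2 -> K) r : {subset r <= T} ->
    {in r, forall x p, f (phi x p) = f p} ->
  forall x, x \in <<[set x in r]>> -> forall p, f (phi x p) = f p.
Proof.
move=> rT fr; apply: gen_seq_ind => [p|x y xr yr IH p];
  first by rewrite morph1 perm1.
by rewrite morphM ?(subsetP (gen_seq_sub rT) x) ?(r_sub rT) // permM fr.
Qed.

Lemma gen_seq_even r : {subset r <= T} ->
    ~~ has (fun x => phi x : bool) r ->
  forall x, x \in <<[set x in r]>> -> ~~ odd_perm (phi x).
Proof.
move=> rT /hasPn er; apply: gen_seq_ind => [|x y xr yr IH].
  by rewrite morph1 odd_perm1.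
rewrite morphM ?(subsetP (gen_seq_sub rT) x) ?(r_sub rT) // odd_permM.
by rewrite (negbTE IH) (negbTE (er y yr)).
Qed.

(** One odd reflection saves a transposition. The clause on [f] passes transitivity, stated through
    invariant functions, from the reflections to the transpositions. *)
Lemma prod_reflection_tperm r : {subset r <= T} ->
  exists l : seq ('I_n.*2 * 'I_n.*2),
  [/\ phi (\prod_(x <- r) x) = \prod_(e <- l) tperm e.1 e.2,
      forall f : 'I_n.*2 -> 'I_n.*2, {in l, forall e, f e.1 = f e.2} ->
        {in r, forall x p, f (phi x p) = f p}
    & size l + has (fun x => phi x : bool) r <= 2 * size r].
Proof.
elim: r => [|x r IH] rT; first by exists [::]; rewrite !big_nil morph1.
have rT' : {subset r <= T} by move=> y yr; apply: rT; rewrite inE yr orbT.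
have xT : x \in T by apply: rT; rewrite mem_head.
have [l [lE lf ls]] := IH rT'; have [k [kE ks]] := T_tperm xT.
exists (k ++ l); split.
- have prW : \prod_(y <- r) y \in W.
    by rewrite big_seq; apply: group_prod => y /(r_sub rT').
  by rewrite big_cons big_cat /= morphM ?(subsetP T_sub x xT) ?lE ?kE.
- move=> f fkl y; rewrite inE => /predU1P[->|yr] p.
    by rewrite kE prod_tperm_invariant // => e ek; rewrite fkl // mem_cat ek.
  by apply: lf => // e el; rewrite fkl // mem_cat el orbT.
- by rewrite size_cat /=; move: ks ls; case: odd_perm; case: has => /=; lia.
Qed.

(** By transitivity the function from [prod_tperm_porbits] has at most one value, and the odd
    reflection leaves at most [2 * size r - 1] transpositions. *)
Lemma porbits_prod_reflection r : {subset r <= T} ->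
    has (fun x => phi x : bool) r ->
    (forall f : 'I_n.*2 -> 'I_n.*2, {in r, forall x p, f (phi x p) = f p} ->
      forall p q, f p = f q) ->
  #|porbits (phi (\prod_(x <- r) x))| + n.*2 <= 2 * size r + 1.
Proof.
move=> rT r_odd r_trans; have [l [-> lf]] := prod_reflection_tperm rT.
rewrite r_odd; have [f [fl]] := prod_tperm_porbits l; rewrite card_ord.
have f1 : #|codom f| <= 1.
  apply/card_le1_eqP=> _ _ /codomP[p ->] /codomP[q ->].
  by apply: r_trans => //; exact: lf.
move: f1; move: #|porbits _| #|codom f| => c k /=; lia.
Qed.

(** A cycle on [n.*2] points is odd for [n > 0], so some factor is odd. The cycle lies in the group
    generated by [r], so this group is transitive and the orbit count applies. *)
Lemma full_cycle_reflection_length r : {subset r <= T} ->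
  full_cycle (phi (\prod_(x <- r) x)) -> n <= size r.
Proof.
move=> rT fc; case: (posnP n) => [-> //|n_gt0].
have lt0 : 0 < n.*2 by lia.
pose p0 : 'I_n.*2 := Ordinal lt0.
have rr : \prod_(x <- r) x \in <<[set x in r]>>.
  by rewrite big_seq; apply: group_prod => y yr; rewrite mem_gen // inE.
have c1 := card_porbits_full_cycle p0 fc.
have r_odd : has (fun x => phi x : bool) r.
  apply/negPn/negP=> /(gen_seq_even rT)/(_ _ rr).
  by rewrite /odd_perm c1 card_ord odd_double.
suff : #|porbits (phi (\prod_(x <- r) x))| + n.*2 <= 2 * size r + 1.
  by rewrite c1; lia.
apply: porbits_prod_reflection => // f fr p q.
have [k ->] := porbitP _ _ _ (fc p q); elim: k => [|k IH];
  first by rewrite perm1.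
by rewrite expgSr permM (gen_seq_invariant rT fr).
Qed.

Hypothesis phi_im : phi @* W = 'C[neg n].

Lemma sigma_im i : i < n -> exists2 x, x \in W & phi x = sigma n i.
Proof.
move=> lt_in; have : sigma n i \in phi @* W.
  by rewrite phi_im; apply/cent1P/commute_sym/sigma_neg.
by case/morphimP=> x _ Wx ->; exists x.
Qed.

(** Some factor is odd because [W] contains the odd [sigma n n.-1]. The orbit count then leaves at
    most one cycle. *)
Lemma generating_reflections_full_cycle r : {subset r <= T} -> size r = n ->
  <<[set x in r]>> = W -> full_cycle (phi (\prod_(x <- r) x)).
Proof.
move=> rT sr rW; apply: full_cycleP; case: (posnP n) => [n0|n_gt0].
  apply: leq_trans (leq_imset_card _ _) _.
  by rewrite card_ord n0.
have r_odd : has (fun x => phi x : bool) r.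
  apply/negPn/negP=> /(gen_seq_even rT) r_even.
  have [a [b [nab sE]]] := @sigma_last_tperm n n.-1 (prednK n_gt0).
  have [|x Wx xE] := @sigma_im n.-1; first by lia.
  by have := r_even x; rewrite rW xE sE odd_tperm nab => /(_ Wx).
have := porbits_prod_reflection rT r_odd; rewrite sr => le.
suff : #|porbits (phi (\prod_(x <- r) x))| + n.*2 <= 2 * n + 1 by lia.
apply: le => f fr.
have fW x (Wx : x \in W) : forall p, f (phi x p) = f p.
  by apply: (gen_seq_invariant rT fr); rewrite rW.
(* The swap of index [mirror n k] moves [k] to [k.+1], so the value at 0 spreads to every point. *)
have f0 k (p q : 'I_n.*2) : p = 0%N :> nat -> q = k :> nat -> f p = f q.
  elim: k q => [|k IH] q p0 qk; first by congr f; apply: val_inj; rewrite /= p0.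
  have ltk : k < n.*2 by have := ltn_ord q; lia.
  have mk : mirror n k < n by rewrite /mirror; lia.
  rewrite (IH (Ordinal ltk)) //; have [x Wx xE] := sigma_im mk.
  rewrite -(fW x Wx); congr f; apply: val_inj; rewrite /= xE sigmaE /=.
  by have [j -> E] := swap_natP k mk; have := ltn_ord q;
    rewrite /mirror in E mk; lia.
move=> p q; have lt0 : 0 < n.*2 by lia.
pose z := Ordinal lt0.
by rewrite -(f0 p z p) // -(f0 q z q).
Qed.

End Reflections.

(** * Reflections as conjugates, and prefixes in the absolute order *)

Section Conclusion.

Local Open Scope group_scope.

Lemma conj_sigma_tperm n (i : 'I_n) (g : {perm 'I_n.*2}) :
  exists l : seq ('I_n.*2 * 'I_n.*2),
    sigma n i ^ g = \prod_(e <- l) tperm e.1 e.2 /\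
    size l + odd_perm (sigma n i ^ g) <= 2.
Proof.
have [l [lE ls]] := sigma_tperm (ltn_ord i).
exists [seq (g e.1, g e.2) | e <- l]; rewrite odd_permJ size_map; split=> //.
rewrite lE big_map (big_morph (conjg^~ g) (fun x y => conjMg x y g) (conj1g g)).
by apply: eq_bigr => e _; rewrite tpermJ.
Qed.

(** The concatenation [t ++ r] is a shortest factorization of [c]; a shorter one of [w^-1 * c], put
    after [t], would shorten it. So [r] is reduced too and the lengths add up. *)
Lemma absolute_order_prefix (gT : finGroupType) (T : {set gT}) (w c : gT)
    (t r : seq gT) m :
  Red T w t -> {subset r <= T} -> c = w * \prod_(x <- r) x ->
  size (t ++ r) = m ->
  (forall r', is_factorization T c r' -> m <= size r') ->
  absolute_order T w c.
Proof.
move=> [[tT wE] tmin] rT cE sm cmin.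
exists (size t), (size r); split.
- by exists t.
- exists r => //; split; first by split=> //; rewrite cE mulKg.
  move=> r' [r'T r'E]; have := cmin (t ++ r').
  rewrite -sm !size_cat leq_add2l; apply; split.
    by move=> x; rewrite mem_cat => /orP[/tT|/r'T].
  by rewrite big_cat /= -wE -r'E mulKVg.
- exists (t ++ r); last by rewrite size_cat.
  split; last by rewrite sm.
  split; last by rewrite big_cat /= -wE -cE.
  by move=> x; rewrite mem_cat => /orP[/tT|/rT].
Qed.

End Conclusion.

Theorem lemma6p4 (gT : finGroupType) (W : {group gT}) (T : {set gT}) (n : nat)
    (hWT : dual_coxeter_system_of_type (@coxeter_matrix_B n) W T)
    (S : {set gT}) (s : 'I_n -> gT)
    (hS : simple_system W T S) (hs : enumerates s S)
    (w : gT) (hw : w \in W) :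
  parabolic_quasi_coxeter_element W T n w ->
  classical_parabolic_coxeter_element W T s w.
Proof.
case=> S' [s' [m [t [[S'T cox'] [_ S'E] le_mn redt genE]]]].
(* Three simple systems occur: [S0] carries the diagram and gives the model, [S'] comes with [w],
   and [S] defines the Coxeter elements. *)
have [S0 [s0 [[S0T cox0] enum0 TE coxB]]] := hWT.
have [phi phi_s0] := sigma_representation cox0 enum0 coxB.
have phi_inj := sigma_representation_inj cox0 enum0 coxB phi_s0.
have phi_im := sigma_representation_im cox0 enum0 phi_s0.
have S0W : S0 \subset W by case: cox0 => _ <- _; exact: subset_gen.
have TW : T \subset W.
  rewrite TE; apply/subsetP=> _ /imset2P[x y Wx /(subsetP S0W) Wy ->].
  by rewrite !groupM ?groupV.
have T_tperm r : r \in T -> exists l : seq ('I_n.*2 * 'I_n.*2),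
    phi r = (\prod_(e <- l) tperm e.1 e.2)%g /\ size l + phi r <= 2.
  rewrite TE => /imset2P[x y Wx S0y ->].
  have Wy := subsetP S0W y S0y.
  have -> : phi (x * y * x^-1)%g = (phi y ^ (phi x)^-1)%g.
    by rewrite !morphM ?groupM ?groupV // morphV // conjgE invgK mulgA.
  have [_ S0E] := enum0; move: S0y; rewrite S0E => /imsetP[i _ ->].
  by rewrite phi_s0; exact: conj_sigma_tperm.
have [[tT wE] _] := redt.
pose rest := [seq s' i | i <- drop m (enum 'I_n)].
have restT : {subset rest <= T}.
  by move=> _ /mapP[i _ ->]; apply: (subsetP S'T); rewrite S'E imset_f.
have catT : {subset t ++ rest <= T}.
  by move=> x; rewrite mem_cat => /orP[/tT|/restT].
have size_cat_n : size (t ++ rest) = n.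
  by rewrite size_cat size_tuple size_map size_drop size_enum_ord subnKC.
have gen_cat : <<[set x in t ++ rest]>>%g = W.
  apply/eqP; rewrite eqEsubset (gen_seq_sub TW catT) /=.
  case: cox' => _ <- _; rewrite gen_subG S'E; apply/subsetP=> _ /imsetP[i _ ->].
  have [le_mi|lt_im] := leqP m i.
    apply: mem_gen; rewrite inE mem_cat; apply/orP; right; apply: map_f.
    have -> : i = nth i (drop m (enum 'I_n)) (i - m).
      by rewrite nth_drop subnKC // nth_ord_enum.
    by rewrite mem_nth // size_drop size_enum_ord ltn_sub2r // (leq_ltn_trans
      le_mi).
  have : s' i \in <<[set s' i | i : 'I_n & i < m]>>%g.
    by apply: mem_gen; apply: imset_f; rewrite inE.
  rewrite -genE; apply: subsetP; apply: genS; apply/subsetP=> x.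
  by rewrite !inE mem_cat => ->.
pose c := (w * \prod_(x <- rest) x)%g.
have cE : c = (\prod_(x <- t ++ rest) x)%g by rewrite big_cat /= -wE.
pose c' := (\prod_(i < n) s i)%g.
have full_c : full_cycle (phi c).
  rewrite cE.
  exact: (generating_reflections_full_cycle TW T_tperm phi_im catT size_cat_n
    gen_cat).
have c'E : c' = (\prod_(x <- [seq s i | i <- enum 'I_n]) x)%g.
  by rewrite big_map enumT /c' [index_enum _]unlock.
have [ST cox] := hS; have [_ SE] := hs; have [_ WE _] := cox.
(* The members of [S] are also [n] reflections generating [W], so the count made for [c] applies to
   [c']. *)
have full_c' : full_cycle (phi c').
  rewrite c'E; apply: (generating_reflections_full_cycle TW T_tperm phi_im).
  - by move=> _ /mapP[i _ ->]; apply: (subsetP ST); rewrite SE imset_f.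
  - by rewrite size_map size_enum_ord.
  rewrite -WE SE; congr <<_>>%g; apply/setP=> x; rewrite inE.
  apply/mapP/imsetP => [] [i _ xE]; exists i => //; exact: mem_enum.
have prodW (r : seq gT) : {subset r <= T} -> (\prod_(x <- r) x)%g \in W.
  by move=> rT; rewrite big_seq; apply: group_prod => x /rT/(subsetP TW).
have Wc : c \in W by rewrite cE; exact: prodW catT.
have Wc' : c' \in W.
  rewrite c'E; apply: prodW => _ /mapP[i _ ->].
  by apply: (subsetP ST); rewrite SE imset_f.
split; first exact: hw.
exists c.
  have [x Wx cxE] := full_cycle_conj_im phi_inj phi_im Wc' Wc full_c' full_c.
  exists 1%g, x; split=> //; rewrite cxE; congr (_ * _ * _)%g.
  by apply: eq_bigr => i _; rewrite perm1.
apply: (absolute_order_prefix redt restT (erefl c) size_cat_n) => r' [r'T r'E].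
by apply: (full_cycle_reflection_length TW T_tperm r'T); rewrite -r'E.
Qed.
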